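(* Let $p$ be an odd prime and let $G$ be a group with $|G|=p^n$ and $|Z(G)|=p^{n-2}$. Let $\Gamma=\zeta(G,G)$ be the commuting graph of $G$. Then the resolving polynomial of $\Gamma$ is $$\beta(\Gamma,x)=x^{p^n-(p+2)}\left[p^{n-2}(p^{n-1}-p^{n-2})^{p+1}+x\,(p^{n-1}-p^{n-2})^{p}\,2p^{n-1}\right]+\sum_{i=p^n-p}^{p^n}s_ix^i,$$ where, for $p^n-p\le i\le p^n$, $$s_i=\binom{p+1}{i-p^n+(p+1)}(p^{n-1}-p^{n-2})^{p^n-i}+p^{n-2}\binom{p+1}{i-p^n+(p+2)}(p^{n-1}-p^{n-2})^{p^n-i-1}.$$
   Context: $Z(G)$ is the center of $G$. The commuting graph $\zeta(G,G)$ is the simple graph with vertex set $G$ in which two distinct vertices are adjacent if and only if they commute in $G$. For a connected graph $\Gamma$ with vertex set $V$, let $d(u,v)$ be the length of a shortest path between $u$ and $v$. A subset $S\subseteq V$ is a resolving set of $\Gamma$ if for every pair of distinct vertices $u,v\in V$ there is $w\in S$ with $d(u,w)\neq d(v,w)$. The metric dimension $\beta(\Gamma)$ is the minimum cardinality of a resolving set. The resolving polynomial is $\beta(\Gamma,x)=\sum_{i=\beta(\Gamma)}^{|V|}s_ix^i$, where $s_i$ is the number of resolving sets of $\Gamma$ of cardinality $i$. Convention: $\binom{a}{b}=0$ for $b>a$ (so for $i=p^n$ the second term of $s_i$ is $0$). *)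

(* Defs.v *)
From HB Require Import structures.
From mathcomp Require Import all_boot all_order all_algebra.
From mathcomp Require Import all_fingroup all_solvable.

Set Implicit Arguments.
Unset Strict Implicit.
Unset Printing Implicit Defensive.

Import GRing.Theory.

Record simple_graph := SimpleGraph {
  vertex :> finType;
  adj : rel vertex;
  adj_sym : symmetric adj;
  adj_irr : irreflexive adj
}.

Section MetricDimension.

Variable Gamma : simple_graph.

(* A shortest path has fewer than #|Gamma| edges, so searching the lengths
   0, ..., #|Gamma| - 1 is exhaustive. The value is #|Gamma| when no path from
   u to v exists, which does not happen in a connected graph. *)
Definition graph_dist (u v : Gamma) : nat :=
  find (fun k => [exists q : k.-tuple Gamma,
                    path (@adj Gamma) u q && (last u q == v)])
       (iota 0 #|Gamma|).

Definition resolving (S : {set Gamma}) : bool :=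
  [forall u : Gamma, forall v : Gamma, (u != v) ==>
     [exists w in S, graph_dist u w != graph_dist v w]].

(* The whole vertex set is resolving, because graph_dist u v = 0 iff u = v;
   it is a legitimate starting point for the minimum. *)
Definition metric_dim : nat :=
  #|[arg min_(S < [set: Gamma] | resolving S) #|S|]|.

Definition num_resolving (i : nat) : nat :=
  #|[set S : {set Gamma} | resolving S & #|S| == i]|.

Definition resolving_poly : {poly int} :=
  (\sum_(metric_dim <= i < #|Gamma|.+1) (num_resolving i)%:R *: 'X^i)%R.

End MetricDimension.

Section CommutingGraph.

Variable gT : finGroupType.

Definition commuting_adj : rel gT :=
  fun x y => (x != y) && (x * y == y * x)%g.

Lemma commuting_adj_sym : symmetric commuting_adj.
Proof. by move=> x y; rewrite /commuting_adj eq_sym [(x * y == _)%g]eq_sym. Qed.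

Lemma commuting_adj_irr : irreflexive commuting_adj.
Proof. by move=> x; rewrite /commuting_adj eqxx. Qed.

Definition commuting_graph : simple_graph :=
  SimpleGraph commuting_adj_sym commuting_adj_irr.

End CommutingGraph.

(* Main.v *)
(* Put two elements of G in the same class when they have the same
   centralizer. Elements of a class are twins in the commuting graph, so a
   resolving set misses at most one element of each class; conversely such a
   set is resolving, because it meets every class of noncentral elements and
   some such class lies in exactly one of two distinct centralizers. Resolving sets are thus
   counted by the product over the classes C of x^(|C|-1) (x + |C|). When
   |G| = p^n and |Z(G)| = p^(n-2), the classes are Z(G) and the p + 1 sets
   C(x) \ Z(G) with x noncentral, each of size m = p^(n-1) - p^(n-2), because
   C(x) is then abelian of order p^(n-1). Expanding
   x^(p^n-(p+2)) (x + p^(n-2)) (x + m)^(p+1) gives the formula. *)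
Require Import Defs.
From mathcomp Require Import all_boot all_order all_algebra.
From mathcomp Require Import all_fingroup all_solvable.
From mathcomp Require Import zify ring.

Set Implicit Arguments.
Unset Strict Implicit.
Unset Printing Implicit Defensive.

Import GRing.Theory.
Local Open Scope ring_scope.

(** * Generating functions of subsets, block by block *)

(** A subset of the cover amounts to an independent choice of its traces on the blocks, so this is
    distributivity read backwards. *)
Lemma sum_subsets_trivIset (T : finType) (R : comNzRingType)
    (P : {set {set T}}) (F : {set T} -> {set T} -> R) :
  trivIset P ->
  \sum_(S : {set T} | S \subset cover P) \prod_(C in P) F C (S :&: C)
  = \prod_(C in P) \sum_(S : {set T} | S \subset C) F C S.
Proof.
(* The default [set0] fixes a family outside [P]; this makes union and trace mutually inverse. *)
move=> tiP; rewrite (big_distr_big_dep set0).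
rewrite (reindex_onto
  (fun f : {ffun {set T} -> {set T}} => \bigcup_(C in P) f C)
  (fun S : {set T} => [ffun C => if C \in P then S :&: C else set0])) /=;
  last first.
  move=> S sSP; under eq_bigr => C CP do rewrite ffunE CP.
  apply/setP=> x; apply/bigcupP/idP => [[C _ /setIP[]] //|xS].
  have /bigcupP[C CP xC] := subsetP sSP _ xS.
  by exists C; rewrite // inE xS.
have capE (f : {ffun {set T} -> {set T}}) C :
    (forall D, D \in P -> f D \subset D) -> C \in P ->
  (\bigcup_(D in P) f D) :&: C = f C.
  move=> fP CP; apply/setP=> x; rewrite inE.
  apply/andP/idP => [[/bigcupP[D DP xD] xC]|xC]; last first.
    by split; [apply/bigcupP; exists C | apply: (subsetP (fP C CP))].
  have xD' := subsetP (fP D DP) _ xD.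
  by rewrite -(def_pblock tiP CP xC) (def_pblock tiP DP xD').
apply: eq_big => [f|f /andP[_ /eqP fE]]; last first.
  apply: eq_bigr => C CP; congr (F C _).
  by rewrite -[in RHS]fE ffunE CP.
apply/andP/pfamilyP => [[sfP /eqP fE]|[sup fP]].
  split=> [|C CP]; last by rewrite -fE ffunE CP unfold_in subsetIr.
  apply/subsetP=> C; rewrite inE; apply: contraR => nCP.
  by rewrite -fE ffunE (negPf nCP).
have {}fP D : D \in P -> f D \subset D by move/fP.
split.
  apply/bigcupsP=> C CP; apply: subset_trans (fP C CP) _.
  exact: bigcup_sup.
apply/eqP/ffunP=> C; rewrite ffunE; case: ifP => CP; first exact: capE.
apply/esym/eqP; apply: contraFT CP => nf; apply: (subsetP sup).
by rewrite inE.
Qed.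

(** Only [C] itself and the [#|C|] sets obtained by deleting one point contribute. *)
Lemma sum_nearly_full_subsets (T : finType) (R : comNzRingType) (x : R)
    (C : {set T}) : (0 < #|C|)%N ->
  \sum_(S : {set T} | S \subset C) (#|C :\: S| <= 1)%:R * x ^+ #|S|
  = x ^+ #|C|.-1 * (x + #|C|%:R).
Proof.
move=> C_gt0.
have draw k : (k <= 1)%N ->
    \sum_(S : {set T} | (S \subset C) && (#|C :\: S| == k))
       (#|C :\: S| <= 1)%:R * x ^+ #|S|
    = x ^+ (#|C| - k) *+ 'C(#|C|, k) :> R.
  move=> k1; have kC : (k <= #|C|)%N by exact: leq_trans k1 C_gt0.
  rewrite -(bin_sub kC) -cards_draws -sumr_const; apply: eq_big => [S|S].
    rewrite inE; case SC: (S \subset C) => //=.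
    rewrite cardsD (setIidPr SC); have := subset_leq_card SC.
    lia.
  case/andP=> SC /eqP cS; rewrite cS k1 mul1r; congr (_ ^+ _).
  rewrite -cS cardsD (setIidPr SC) subKn //; exact: subset_leq_card.
rewrite (bigID (fun S : {set T} => #|C :\: S| == 0%N)) /= draw //.
rewrite (bigID (fun S : {set T} => #|C :\: S| == 1%N)) /=.
rewrite [X in _ + (_ + X)]big1 ?addr0 => [|S]; last first.
  case/andP=> /andP[_ n0] n1; rewrite leqNgt ltn_neqAle eq_sym n1 lt0n n0.
  by rewrite mul0r.
have -> : \sum_(S : {set T} | (S \subset C) && (#|C :\: S| != 0%N)
                     && (#|C :\: S| == 1%N))
       (#|C :\: S| <= 1)%:R * x ^+ #|S| = x ^+ (#|C| - 1) *+ 'C(#|C|, 1) :> R.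
  rewrite -draw //; apply: eq_bigl => S.
  by rewrite -andbA; congr (_ && _); case: #|_| => [|[|]].
by rewrite subn0 bin0 bin1 subn1 mulrDr -exprSr prednK // mulr_natr.
Qed.

(** * The resolving polynomial as a sum over resolving sets *)

Lemma graph_dist_eq0 (Gamma : simple_graph) (u v : Gamma) :
  (graph_dist u v == 0%N) = (u == v).
Proof.
have /prednK cG : (0 < #|Gamma|)%N by apply/card_gt0P; exists u.
rewrite /graph_dist -cG /=; case: existsP => [[q]|nq].
  by rewrite tuple0 /= => ->.
by apply/esym/negP=> uv; apply: nq; exists [tuple].
Qed.

Lemma resolving_setT (Gamma : simple_graph) : resolving [set: Gamma].
Proof.
apply/forallP=> u; apply/forallP=> v; apply/implyP=> nuv.
apply/exists_inP; exists u; rewrite ?inE //.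
have /eqP -> : graph_dist u u == 0%N by rewrite graph_dist_eq0.
by rewrite eq_sym graph_dist_eq0 eq_sym.
Qed.

(** The lower summation bound can drop to 0, as no resolving set is smaller than the metric
    dimension; the rest is grouping by cardinality. *)
Lemma resolving_poly_sum (Gamma : simple_graph) :
  resolving_poly Gamma
  = \sum_(S : {set Gamma} | resolving S) 'X^#|S| :> {poly int}.
Proof.
have dim_min (S : {set Gamma}) :
    resolving S -> (metric_dim Gamma <= #|S|)%N.
  rewrite /metric_dim; case: arg_minnP => [|S0 _]; last exact.
  exact: resolving_setT.
have num0 i : (i < metric_dim Gamma)%N -> num_resolving Gamma i = 0%N.
  move=> i_lt; apply/eqP; rewrite cards_eq0; apply: contraTT i_lt.
  by case/set0Pn=> S; rewrite inE -leqNgt => /andP[/dim_min le_S /eqP <-].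
have numE i : (num_resolving Gamma i)%:R *: 'X^i
    = \sum_(S : {set Gamma} | resolving S && (#|S| == i)) 'X^#|S|
    :> {poly int}.
  transitivity (\sum_(S in [set S : {set Gamma} | resolving S & #|S| == i])
                  'X^i : {poly int}).
    by rewrite sumr_const scaler_nat.
  by apply: eq_big => [S|S]; rewrite inE // => /andP[_ /eqP ->].
rewrite /resolving_poly (big_nat_widenl _ 0) //= [LHS]big_mkcond /=.
rewrite (partition_big (fun S : {set Gamma} => inord #|S| : 'I_#|Gamma|.+1)
  xpredT) //= big_mkord; apply: eq_bigr => i _.
have -> : (if (metric_dim Gamma <= i)%N
    then (num_resolving Gamma i)%:R *: 'X^i else 0 : {poly int})
  = (num_resolving Gamma i)%:R *: 'X^i.
  by case: leqP => // /num0->; rewrite scale0r.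
rewrite numE; apply: eq_bigl => S; congr (_ && _).
by rewrite -val_eqE /= inordK // ltnS max_card.
Qed.

(** * Distances and resolving sets in the commuting graph *)

Section CentralizerClasses.
Variable gT : finGroupType.
Implicit Types (x y u v w : gT) (S : {set gT}).

(** The identity is joined to every other element, so distances are at most 2. The bound on [#|gT|]
    ensures that the lengths 0, 1 and 2 are all searched. *)
Lemma commuting_graph_dist u v : (2 < #|gT|)%N ->
  @graph_dist (commuting_graph gT) u v
  = if u == v then 0%N else if (u * v == v * u)%g then 1%N else 2%N.
Proof.
move=> gT_gt2; rewrite /graph_dist.
have -> : #|commuting_graph gT| = (#|gT| - 3).+3 by rewrite -addn3 subnK.
rewrite /=; have [<-|nuv] := eqVneq u v.
  by case: ifP => // /existsP[]; exists [tuple] => /=; rewrite eqxx.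
case: ifP => [/existsP[q]|_]; first by rewrite tuple0 /= (negPf nuv).
have [cuv|ncuv] := eqVneq (u * v)%g (v * u)%g.
  case: ifP => // /existsP[]; exists [tuple v] => /=.
  by rewrite /commuting_adj nuv cuv !eqxx.
case: ifP => [/existsP[q]|_].
  case: (tupleP q) => w q' /=; rewrite tuple0 /= andbT => /andP[aw /eqP wv].
  by move: aw; rewrite wv /commuting_adj (negPf ncuv) andbF.
case: ifP => // /existsP[]; exists [tuple 1%g; v] => /=.
rewrite /commuting_adj !mulg1 !mul1g !eqxx !andbT.
by apply/andP; split; apply: contraNneq ncuv; [move-> | move<-];
  rewrite mulg1 mul1g.
Qed.

Definition cent_classes : {set {set gT}} :=
  preim_partition (fun x => 'C[x]%g) [set: gT].

Lemma cent_classesP : partition cent_classes [set: gT].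
Proof. exact: preim_partitionP. Qed.

Lemma cent_classes_trivIset : trivIset cent_classes.
Proof. by have /and3P[] := cent_classesP. Qed.

Lemma cent_classes_cover : cover cent_classes = [set: gT].
Proof. by have /and3P[/eqP] := cent_classesP. Qed.

Lemma mem_cent_classes C :
  reflect (exists x, C = [set y | 'C[y] == 'C[x]]%g) (C \in cent_classes).
Proof.
apply: (iffP imsetP) => [[x _ ->]|[x ->]]; exists x => //.
  by apply/setP=> y; rewrite !inE eq_sym.
by apply/setP=> y; rewrite !inE eq_sym.
Qed.

Lemma resolving_commuting S : (2 < #|gT|)%N ->
    (forall C, C \in cent_classes -> (1 < #|C|)%N \/ C = 'Z([set: gT])%g) ->
  @resolving (commuting_graph gT) S
  = [forall C in cent_classes, (#|C :\: S| <= 1)%N].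
Proof.
move=> gT_gt2 bigC.
have comm_cent u v : (u * v == v * u)%g = (v \in 'C[u]%g).
  by rewrite cent1E eq_sym.
apply/idP/forall_inP => [rS C /mem_cent_classes[x ->]|oneC].
  (* Two missed elements of one class have equal distances to every [w] in [S], since [w] is neither
     of them. *)
  rewrite leqNgt; apply/negP=> /card_gt1P[u [v [uD vD nuv]]].
  move: uD vD; rewrite !inE => /andP[nuS /eqP Cu] /andP[nvS /eqP Cv].
  have /forallP/(_ u)/forallP/(_ v) := rS; rewrite nuv /= => /exists_inP[w wS].
  rewrite !commuting_graph_dist // !comm_cent Cu Cv.
  have -> : u == w = false by apply: contraNF nuS => /eqP->.
  have -> : v == w = false by apply: contraNF nvS => /eqP->.
  by rewrite eqxx.
(* As [a] does not commute with [v], it is not central, so its class has two elements and meets [S].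
   Any [w] there commutes with the same elements as [a]. *)
have sep u v a : a \in 'C[u]%g -> a \notin 'C[v]%g ->
    exists2 w, w \in S & w \in 'C[u]%g /\ w \notin 'C[v]%g.
  move=> au nav; pose C := [set y | 'C[y] == 'C[a]]%g.
  have CP : C \in cent_classes by apply/mem_cent_classes; exists a.
  have aC : a \in C by rewrite inE.
  have C2 : (1 < #|C|)%N.
    case: (bigC C CP) => // CZ; case/negP: nav; rewrite cent1C.
    move: aC; rewrite CZ => /setIP[_ /centP aZ].
    by apply/cent1P/commute_sym/aZ; rewrite inE.
  have /set0Pn[w] : C :&: S != set0.
    apply: contraTneq (oneC C CP) => CS0; rewrite cardsD CS0 cards0 subn0.
    by rewrite -ltnNge.
  rewrite !inE => /andP[/eqP Cw wS]; exists w => //.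
  by rewrite cent1C Cw -cent1C au -[w \in _]cent1C Cw -cent1C nav.
apply/forallP=> u; apply/forallP=> v; apply/implyP=> nuv.
apply/exists_inP; have [Cuv|] := eqVneq ('C[u])%g ('C[v])%g; last first.
  rewrite eqEsubset negb_and => /orP[] /subsetPn[a a1 a2].
    (* Here [w] is at distance 2 from [v] and at most 1 from [u]. *)
    have [w wS [w1 w2]] := sep _ _ _ a1 a2; exists w => //.
    rewrite !commuting_graph_dist // !comm_cent w1 (negPf w2).
    case: (eqVneq v w) => [vw|_]; first by rewrite -vw cent1id in w2.
    by case: (u == w).
  have [w wS [w1 w2]] := sep _ _ _ a1 a2; exists w => //.
  rewrite !commuting_graph_dist // !comm_cent w1 (negPf w2).
  case: (eqVneq u w) => [vw|_]; first by rewrite -vw cent1id in w2.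
  by case: (v == w).
have CP : [set y | 'C[y] == 'C[v]]%g \in cent_classes.
  by apply/mem_cent_classes; exists v.
(* Twins [u] and [v] are not both missed; whichever lies in [S] is at distance 0 from itself
   only. *)
have := oneC _ CP; rewrite leqNgt => /card_gt1P notwo.
have [uS|nuS] := boolP (u \in S).
  exists u => //; rewrite !commuting_graph_dist // eqxx [v == u]eq_sym (negPf nuv).
  by case: ifP.
have [vS|nvS] := boolP (v \in S).
  exists v => //; rewrite !commuting_graph_dist // eqxx (negPf nuv).
  by case: ifP.
by case: notwo; exists u, v; rewrite !inE nuS nvS Cuv eqxx.
Qed.

End CentralizerClasses.

(** * Centralizers when the center has index [p ^ 2] *)

Lemma central_classE (gT : finGroupType) (x : gT) :
  x \in 'Z([set: gT])%g -> [set y | 'C[y] == 'C[x]]%g = 'Z([set: gT])%g.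
Proof.
have cZ y : (y \in 'Z([set: gT])%g) = ('C[y]%g == [set: gT]).
  rewrite inE in_setT /= -sub1set centsC eqEsubset subsetT /=.
  by rewrite cent_set1.
by rewrite cZ => /eqP Cx; apply/setP=> y; rewrite inE Cx cZ.
Qed.

Lemma center_sub_cent1 (gT : finGroupType) (x : gT) :
  'Z([set: gT])%g \subset 'C[x]%g.
Proof.
apply/subsetP=> y /setIP[_ /centP cy]; apply/cent1P/esym.
by apply/commute_sym/cy; rewrite inE.
Qed.

(** The centralizer of [x] lies strictly between the center and the group, which forces its order.
    Its own center contains [x] besides the center of the group, so by the same count it is the
    whole centralizer. *)
Lemma cent1_noncentral (gT : finGroupType) (p k : nat) (x : gT) :
    prime p -> #|[set: gT]| = (p ^ k.+2)%N ->
    #|'Z([set: gT])%g| = (p ^ k)%N -> x \notin 'Z([set: gT])%g ->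
  #|'C[x]%g| = (p ^ k.+1)%N /\ abelian 'C[x]%g.
Proof.
move=> p_pr cG cZ nxZ; have p_gt1 := prime_gt1 p_pr.
have sZC := center_sub_cent1 x.
have between (H : {group gT}) : ('Z([set: gT])%g \proper H) ->
    (p ^ k < #|H|)%N by move/proper_card; rewrite cZ.
have xC : x \in 'C[x]%g by rewrite cent1id.
have C_gt : (p ^ k < #|'C[x]%g|)%N.
  by apply: between; apply/properP; split=> //; exists x.
have C_lt : (#|'C[x]%g| < p ^ k.+2)%N.
  rewrite -cG; apply: proper_card; rewrite properEneq subsetT andbT.
  apply: contraNneq nxZ => CG; rewrite inE in_setT /=.
  by apply/centP=> y _; apply/commute_sym/cent1P; rewrite CG inE.
have cC : #|'C[x]%g| = (p ^ k.+1)%N.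
  have : (#|'C[x]%g| %| p ^ k.+2)%N by rewrite -cG cardSg ?subsetT.
  case/(dvdn_pfactor _ _ p_pr) => j _ cCj; move: C_gt C_lt.
  rewrite cCj !ltn_exp2l // => j1 j2; congr (_ ^ _)%N; lia.
split=> //.
have Z_gt : (p ^ k < #|'Z('C[x])%g|)%N.
  apply: between; apply/properP; split; last first.
    exists x => //; rewrite inE cent1id /=; apply/centP=> y.
    by rewrite cent1E => /eqP cy; apply: commute_sym; rewrite /commute cy.
  apply/subsetP=> y yZ; rewrite inE (subsetP sZC) //=.
  by case/setIP: yZ => _ /centP cy; apply/centP=> w _; apply: cy; rewrite inE.
have cZC : #|'Z('C[x])%g| = (p ^ k.+1)%N.
  have : (#|'Z('C[x])%g| %| p ^ k.+1)%N by rewrite -cC cardSg ?center_sub.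
  case/(dvdn_pfactor _ _ p_pr) => j jk cCj; move: Z_gt.
  rewrite cCj !ltn_exp2l // => j1; congr (_ ^ _)%N; lia.
have /eqP <- : 'Z('C[x])%g == 'C[x]%g; last exact: center_abelian.
by rewrite eqEcard center_sub cC cZC leqnn.
Qed.

(** If a noncentral [y] lies in the abelian group ['C[x]], then ['C[x]] is contained in ['C[y]], and
    the two orders agree. *)
Lemma noncentral_classE (gT : finGroupType) (p k : nat) (x : gT) :
    prime p -> #|[set: gT]| = (p ^ k.+2)%N ->
    #|'Z([set: gT])%g| = (p ^ k)%N -> x \notin 'Z([set: gT])%g ->
  [set y | 'C[y] == 'C[x]]%g = 'C[x]%g :\: 'Z([set: gT])%g.
Proof.
move=> p_pr cG cZ nxZ; apply/setP=> y; rewrite [LHS]inE [RHS]in_setD.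
have [cCx abC] := cent1_noncentral p_pr cG cZ nxZ.
have [yZ|nyZ] := boolP (y \in 'Z([set: gT])%g).
  have := central_classE yZ; move/setP/(_ x); rewrite inE (negPf nxZ).
  by rewrite eq_sym => ->.
have [cCy _] := cent1_noncentral p_pr cG cZ nyZ.
rewrite /=; apply/eqP/idP => [<-|yCx]; first exact: cent1id.
apply/esym/eqP; rewrite eqEcard cCx cCy leqnn andbT.
by apply/subsetP=> w wC; apply/cent1P; apply: (centsP abC).
Qed.

(** * The product formula, its factors for the [p]-group, and its expansion *)

Lemma resolving_poly_classes (gT : finGroupType) : (2 < #|gT|)%N ->
    (forall C, C \in cent_classes gT ->
       (1 < #|C|)%N \/ C = 'Z([set: gT])%g) ->
  resolving_poly (commuting_graph gT)
  = \prod_(C in cent_classes gT) ('X^(#|C|.-1) * ('X + #|C|%:R)).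
Proof.
move=> gT_gt2 bigC; rewrite resolving_poly_sum.
have /and3P[_ _ n0] := cent_classesP gT.
under [RHS]eq_bigr => C CP.
  rewrite -sum_nearly_full_subsets; last first.
    by rewrite card_gt0; apply: contraNneq n0 => <-.
  over.
rewrite -(sum_subsets_trivIset (fun C S : {set gT} =>
  (#|C :\: S| <= 1)%:R * 'X^#|S|)) ?cent_classes_trivIset //.
rewrite cent_classes_cover [LHS]big_mkcond [RHS]big_mkcond /=.
apply: eq_bigr => S _; rewrite subsetT resolving_commuting //.
rewrite big_split /= prodrXr.
(* The exponents add up because the classes partition the group. *)
have -> : \sum_(C in cent_classes gT) #|S :&: C| = #|S|.
  transitivity (\sum_(C in cent_classes gT) \sum_(x in C) (x \in S : nat))%N.
    apply: eq_bigr => C _; rewrite -sum1_card big_mkcond [RHS]big_mkcond /=.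
    by apply: eq_bigr => x _; rewrite inE; do 2!case: (x \in _).
  rewrite -(big_trivIset _ (cent_classes_trivIset gT)) cent_classes_cover.
  rewrite -sum1_card [RHS]big_mkcond.
  by apply: eq_big => [x|x _]; rewrite ?inE //; case: ifP.
case: ifP => [/forall_inP oneC|/negbT/forall_inPn[C CP nC]].
  rewrite big1 ?mul1r // => C CP.
  by rewrite setDIr setDv setU0 oneC.
by rewrite (bigD1 C) //= setDIr setDv setU0 (negPf nC) !mul0r.
Qed.

Lemma resolving_poly_p_group (gT : finGroupType) (p k : nat) :
    prime p -> odd p -> #|[set: gT]| = (p ^ k.+2)%N ->
    #|'Z([set: gT])%g| = (p ^ k)%N ->
  resolving_poly (commuting_graph gT)
  = 'X^(p ^ k.+2 - p.+2)
      * (('X + ((p ^ k)%:R : int)%:P)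
         * ('X + ((p ^ k.+1)%:R - (p ^ k)%:R : int)%:P) ^+ p.+1).
Proof.
move=> p_pr p_odd cG cZ.
have p_gt2 : (2 < p)%N by apply: odd_prime_gt2.
have pk_gt0 : (0 < p ^ k)%N by rewrite expn_gt0 prime_gt0.
pose m := (p ^ k.+1 - p ^ k)%N.
have mE : (m = p.-1 * p ^ k)%N.
  by rewrite /m expnS -[X in (_ - X)%N]mul1n -mulnBl subn1.
(* Since [p] is at least 3, noncentral classes have at least two elements, as the product formula
   demands. *)
have m_gt1 : (1 < m)%N by rewrite /m expnS; nia.
set Z := 'Z([set: gT])%g.
have ZP : Z \in cent_classes gT.
  apply/mem_cent_classes; exists 1%g.
  by rewrite central_classE //= group1.
have cardP C : C \in cent_classes gT :\ Z -> #|C| = m.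
  case/setD1P=> nCZ /mem_cent_classes[x Cx]; move: nCZ; rewrite {}Cx.
  have [xZ|nxZ _] := boolP (x \in Z); first by rewrite central_classE ?eqxx.
  have [cCx _] := cent1_noncentral p_pr cG cZ nxZ.
  rewrite (noncentral_classE p_pr cG cZ nxZ) cardsD cCx.
  congr (_ - _)%N; rewrite -cZ; apply: eq_card => y; rewrite inE.
  by apply: andb_idl => yZ; apply: subsetP yZ; apply: center_sub_cent1.
(* Counting the group class by class gives [p ^ k.+2 = p ^ k + N * m] for the number [N] of
   noncentral classes. *)
have cardPZ : #|cent_classes gT :\ Z| = p.+1.
  have := card_partition (cent_classesP gT).
  rewrite (big_setD1 Z) //= (eq_bigr (fun=> m)) // sum_nat_const cG cZ.
  have -> : (p ^ k.+2 = p ^ k + p.+1 * m)%N.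
    rewrite mE !expnS; have := ltn_predK p_gt2.
    by move: (p ^ k)%N p.-1 => P q <-; ring.
  by move/addnI/eqP; rewrite eqn_pmul2r ?(ltnW m_gt1) // => /eqP.
rewrite resolving_poly_classes; first last.
- move=> C CP; have [->|nCZ] := eqVneq C Z; first by right.
  by left; rewrite cardP // in_setD1 nCZ.
- rewrite -cardsT cG expnS (leq_trans p_gt2) // leq_pmulr //.
  by rewrite expn_gt0 prime_gt0.
rewrite (big_setD1 Z) //= (eq_bigr (fun=> 'X^(m.-1) * ('X + m%:R))); last first.
  by move=> C /cardP->.
rewrite prodr_const cardPZ cZ -natrB; last by rewrite leq_exp2l // ltnW.
rewrite !rmorph_nat -/m exprMn -exprM.
have -> : (p ^ k.+2 - p.+2 = (p ^ k).-1 + m.-1 * p.+1)%N.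
  by rewrite /m !expnS; nia.
by rewrite exprD; ring.
Qed.

(* At j = q the truncated exponent q - j.+1 comes with 'C(q, q.+1) = 0. *)
Lemma mul_binomialX (R : comNzRingType) (q : nat) (z m : R) :
  ('X + z%:P) * ('X + m%:P) ^+ q
  = (z * m ^+ q)%:P
    + \sum_(0 <= j < q.+1)
        (m ^+ (q - j) *+ 'C(q, j) + z * m ^+ (q - j.+1) *+ 'C(q, j.+1))%:P
          * 'X^(j.+1).
Proof.
rewrite [X in X ^+ q]addrC exprDn mulrDl !mulr_sumr.
(* With the constant term of the [z] part split off, both parts can be indexed by the degree
   [j.+1]. *)
rewrite [X in _ + X]big_ord_recl /= subn0 bin0 mulr1n expr0 mulr1.
rewrite -polyC_exp -polyCM addrCA; congr (_ + _).
under eq_bigr => j _ do rewrite mulrnAr mulrCA -exprS.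
rewrite big_mkord [RHS](eq_bigr (fun j : 'I_q.+1 =>
    (m ^+ (q - j) *+ 'C(q, j))%:P * 'X^(j.+1)
    + (z * m ^+ (q - j.+1) *+ 'C(q, j.+1))%:P * 'X^(j.+1))); last first.
  by move=> j _; rewrite polyCD mulrDl.
rewrite big_split /=; congr (_ + _).
  by apply: eq_bigr => j _; rewrite polyCMn polyC_exp mulrnAl.
rewrite [RHS]big_ord_recr /= bin_small // mulr0n mul0r addr0.
by apply: eq_bigr => j _; rewrite polyCMn polyCM polyC_exp mulrnAl mulrnAr mulrA.
Qed.

(* The truncated natural-number subtractions below all have nonnegative true
   value, except p ^ n - i - 1 at i = p ^ n, where the binomial coefficient in
   front is 'C(p + 1, p + 2) = 0. *)
Theorem theorem5p3 (p n : nat) (gT : finGroupType)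
  (p_prime : prime p) (p_odd : odd p) (n_ge2 : (2 <= n)%N)
  (cardG : #|[set: gT]| = (p ^ n)%N)
  (cardZ : #|'Z([set: gT])%g| = (p ^ (n - 2))%N) :
  let z : int := (p ^ (n - 2))%:R in
  let m : int := (p ^ (n - 1))%:R - (p ^ (n - 2))%:R in
  let s (i : nat) : int :=
    'C(p + 1, i + (p + 1) - p ^ n)%:R * m ^+ (p ^ n - i)
    + z * 'C(p + 1, i + (p + 2) - p ^ n)%:R * m ^+ (p ^ n - i - 1) in
  resolving_poly (commuting_graph gT)
  = 'X^(p ^ n - (p + 2))
      * ((z * m ^+ (p + 1))%:P
         + 'X * (m ^+ p * (2 * (p ^ (n - 1))%:R))%:P)
    + \sum_(p ^ n - p <= i < (p ^ n).+1) (s i)%:P * 'X^i.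
Proof.
case: n n_ge2 cardG cardZ => [|[|k]] // _; rewrite !subSS !subn0 => cG cZ.
move=> z m s; rewrite (resolving_poly_p_group p_prime p_odd cG cZ).
have p_gt2 : (2 < p)%N by apply: odd_prime_gt2.
have pk_gt0 : (0 < p ^ k)%N by rewrite expn_gt0 prime_gt0.
set e := (p ^ k.+2 - p.+2)%N.
have eE : (p ^ k.+2 = e + p.+2)%N by rewrite subnK // !expnS; nia.
rewrite mul_binomialX big_nat_recl // bin0 bin1 /s eE; clearbody e.
have -> : (e + p.+2 - p = e.+2)%N by lia.
have -> : (e + p.+2).+1 = (p.+1 + e.+2)%N by lia.
have -> : (e + p.+2 - (p + 2) = e)%N by lia.
(* Shifting by [e.+2] aligns the two sums; the coefficients of degrees [e] and [e.+1] are compared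
   separately. *)
rewrite -{1}[e.+2]add0n big_addn addnK addrA mulrDr; congr (_ + _).
  congr (_ * (_%:P + _)); first by rewrite addn1.
  rewrite expr1 mulrC; congr ('X * _%:P).
  (* The coefficient is [m ^+ p * (m + (p + 1) * z)], and [m = p * z - z] turns the second factor
     into [2 * p * z]. *)
  rewrite subn0 subn1 /= mulr1n -/m.
  have -> : m ^+ p.+1 = m ^+ p * m by rewrite exprSr.
  have pzE : (p ^ k.+1)%:R = p%:R * z :> int by rewrite expnS natrM.
  have mE : m = p%:R * z - z by rewrite -pzE.
  rewrite pzE -mulr_natr -natr1 -/z [X in _ * X + _]mE.
  by move: (m ^+ p) => mp; ring.
rewrite mulr_sumr; apply: eq_big_nat => j /= jp.
have -> : (j + e.+2 + (p + 1) - (e + p.+2) = j.+1)%N by lia.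
have -> : (j + e.+2 + (p + 2) - (e + p.+2) = j.+2)%N by lia.
have -> : (e + p.+2 - (j + e.+2) - 1 = p.+1 - j.+2)%N by lia.
have -> : (e + p.+2 - (j + e.+2) = p.+1 - j.+1)%N by lia.
rewrite addn1 !addnS !exprS exprD -/z -/m.
rewrite -[in LHS]mulr_natl -[in LHS](mulr_natl (z * _)) mulrCA.
by rewrite [z * _%:R in RHS]mulrC -[in RHS](mulrA _ z); ring.
Qed.
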